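(* Consider the agglomeration phase of P-RASTER (described in the context) applied to a finite set $S\subset\mathbb{Z}^2$ of significant tiles, with minimum cluster size $\mu$ and arbitrary borders $b_1<\dots<b_{N-1}$. Fix a border $B_i$ ($1\le i\le N-1$) and let $C_1,\dots,C_r$ ($r\ge 2$) be per-slice clusters, each lying in slice $i$ or slice $i+1$, such that $C_1\cup\dots\cup C_r$ is connected in the neighbor graph on $S$ (so that, without the border $B_i$, they would form one single cluster). Then, when the algorithm terminates, $C_1,\dots,C_r$ have all been joined into one and the same joined cluster, regardless of how many such clusters there are and on which side of $B_i$ each of them lies.
   Context: Tiles are integer grid cells $(x,y)\in\mathbb{Z}^2$. Two tiles are neighbors if their Chebyshev distance is exactly $1$ (the eight surrounding cells). For a set of tiles, its clusters are the connected components of the graph on those tiles whose edges join neighboring tiles. Two sets of tiles are adjacent if some tile of one is a neighbor of some tile of the other. P-RASTER agglomeration. Input: a finite set $S$ of significant tiles, a minimum cluster size $\mu$, and integers $b_1<\dots<b_{N-1}$ (vertical borders). Put $b_0=-\infty$, $b_N=+\infty$; slice $k$ ($1\le k\le N$) consists of the tiles of $S$ with $b_{k-1}\le x<b_k$, and border $B_k$ ($1\le k\le N-1$) separates slices $k$ and $k+1$. A set of tiles touches $B_k$ if it contains a tile with $x=b_k-1$ or $x=b_k$. Step 1 (in parallel per slice): compute the clusters of the tiles of each slice (per-slice clusters); a per-slice cluster touching some border is put into the candidate set $C_b$; otherwise it is output if it has at least $\mu$ tiles and discarded otherwise. Step 2 (joining, for $i=N-1,N-2,\dots,1$ in this order):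 let $C_{lr}$ be the clusters in $C_b$ that touch $B_i$; repeatedly merge clusters of $C_{lr}$ that are adjacent (a depth-first search over clusters, merging each newly found adjacent cluster into the current joined cluster) until the elements of $C_{lr}$ are grouped into maximal joined clusters; each joined cluster that touches $B_{i-1}$ is returned to $C_b$ as a candidate for the next border (replacing its constituents), and each other joined cluster is output if it has at least $\mu$ tiles and discarded otherwise. The output is the set of all output clusters. *)

(* Defs.v *)
From mathcomp Require Import all_boot all_order all_algebra.
From mathcomp Require Import finmap.

Set Implicit Arguments.
Unset Strict Implicit.
Unset Printing Implicit Defensive.

Import Order.TTheory GRing.Theory Num.Theory.
Local Open Scope ring_scope.
Local Open Scope fset_scope.

Notation tile := (int * int)%type.

Definition neighbor (t u : tile) : bool :=
  Num.max `|t.1 - u.1| `|t.2 - u.2| == 1.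

Definition adjacent (A B : {fset tile}) : bool :=
  [exists t : A, [exists u : B, neighbor (val t) (val u)]].

(* Reachability in the neighbor graph induced on A. *)
Definition linked (A : {fset tile}) : rel A :=
  connect (fun t u : A => neighbor (val t) (val u)).

Definition clusters (A : {fset tile}) : {fset {fset tile}} :=
  [fset [fset val u | u : A & linked t u] | t : A].

Definition connected (A : {fset tile}) : Prop := forall t u : A, linked t u.

(* Borders are b 1 < ... < b N.-1; the values b 0 and b k for k >= N are never
   used, the bounds b_0 = -oo and b_N = +oo being rendered by the absence of
   the corresponding constraint. *)
Definition in_slice (N : nat) (b : nat -> int) (k : nat) (t : tile) : bool :=
  ((1 < k)%N ==> (b k.-1 <= t.1)) && ((k < N)%N ==> (t.1 < b k)).

Definition slice (N : nat) (b : nat -> int) (S : {fset tile}) (k : nat) :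
  {fset tile} := [fset t in S | in_slice N b k t].

Definition touches (N : nat) (b : nat -> int) (k : nat) (A : {fset tile}) :
  bool :=
  (0 < k < N)%N && [exists t : A, (val t).1 \in [:: b k - 1; b k]].

Definition touches_some (N : nat) (b : nat -> int) (A : {fset tile}) : bool :=
  [exists k : 'I_N, touches N b k A].

(* Besides the candidate set C_b and the output, a state records the clusters
   that have been discarded for being too small, so that the fate of every
   cluster can be followed up to termination. *)
Record state := State {
  candidates : {fset {fset tile}};
  output     : {fset {fset tile}};
  discarded  : {fset {fset tile}} }.

Definition slice_clusters (N : nat) (b : nat -> int) (S : {fset tile}) :
  {fset {fset tile}} := \bigcup_(k <- iota 1 N) clusters (slice N b S k).

Definition init_state (mu N : nat) (b : nat -> int) (S : {fset tile}) : state :=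
  let P := slice_clusters N b S in
  State [fset A in P | touches_some N b A]
        [fset A in P | ~~ touches_some N b A && (mu <= #|` A|)%N]
        [fset A in P | ~~ touches_some N b A && (#|` A| < mu)%N].

(* [dfs R s J R' J']: a depth-first search with unvisited clusters R, stack s
   (top first) and current joined cluster J ends with unvisited clusters R' and
   joined cluster J'. The order in which adjacent clusters are visited is left
   arbitrary. *)
Inductive dfs : {fset {fset tile}} -> seq {fset tile} -> {fset tile} ->
                {fset {fset tile}} -> {fset tile} -> Prop :=
| dfs_stop R J : dfs R [::] J R J
| dfs_found R A s J B R' J' :
    B \in R -> adjacent A B ->
    dfs (R `\ B) [:: B, A & s] (J `|` B) R' J' ->
    dfs R (A :: s) J R' J'
| dfs_backtrack R A s J R' J' :
    (forall B, B \in R -> ~~ adjacent A B) ->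
    dfs R s J R' J' ->
    dfs R (A :: s) J R' J'.

(* [joining R F]: repeatedly starting a search from an arbitrary remaining
   cluster groups the clusters of R into the set F of joined clusters. *)
Inductive joining : {fset {fset tile}} -> {fset {fset tile}} -> Prop :=
| joining_stop : joining fset0 fset0
| joining_search R A R' J F :
    A \in R -> dfs (R `\ A) [:: A] A R' J -> joining R' F ->
    joining R (J |` F).

Inductive join_border (mu N : nat) (b : nat -> int) (i : nat) (s : state) :
  state -> Prop :=
| JoinBorder F :
    let Clr := [fset A in candidates s | touches N b i A] in
    joining Clr F ->
    join_border mu N b i s
      (State ((candidates s `\` Clr) `|` [fset D in F | touches N b i.-1 D])
             (output s `|`
                [fset D in F | ~~ touches N b i.-1 D && (mu <= #|` D|)%N])
             (discarded s `|`
                [fset D in F | ~~ touches N b i.-1 D && (#|` D| < mu)%N])).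

(* Borders i, i.-1, ..., 1 are processed in this order. *)
Inductive join_borders (mu N : nat) (b : nat -> int) :
  nat -> state -> state -> Prop :=
| join_borders0 s : join_borders mu N b 0 s s
| join_bordersS i s s' s'' :
    join_border mu N b i.+1 s s' -> join_borders mu N b i s' s'' ->
    join_borders mu N b i.+1 s s''.

Definition praster (mu N : nat) (b : nat -> int) (S : {fset tile})
  (final : state) : Prop :=
  join_borders mu N b N.-1 (init_state mu N b S) final.

Lemma dfs_total R s J :
  exists R' J', dfs R s J R' J' /\ R' `<=` R.
Proof.
have [n] := ubnP #|` R|; elim: n => // n IHn in R s J *; move=> ltRn.
elim: s J => [|A s IHs] J; first by exists R, J; split=> //; constructor.
have [/existsP[B adjAB] | noB] := boolP [exists B : R, adjacent A (val B)].
  have BR := valP B.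
  have [|R' [J' [runB subR']]] := IHn (R `\ val B) [:: val B, A & s] (J `|` val B).
    by move: ltRn; rewrite (cardfsD1 (val B) R) BR.
  exists R', J'; split; first exact: dfs_found adjAB runB.
  exact: fsubset_trans subR' (fsubD1set _ _).
have [R' [J' [run subR']]] := IHs J; exists R', J'; split=> //.
apply: dfs_backtrack run => B BR; apply: contra noB => adjAB.
by apply/existsP; exists [` BR].
Qed.

Lemma joining_total R : exists F, joining R F.
Proof.
have [n] := ubnP #|` R|; elim: n => // n IHn in R *; move=> ltRn.
have [->|[A AR]] := fset_0Vmem R; first by exists fset0; constructor.
have [R' [J [run subR']]] := dfs_total (R `\ A) [:: A] A.
have [|F joinF] := IHn R'.
  apply: leq_ltn_trans (fsubset_leq_card subR') _.
  by move: ltRn; rewrite (cardfsD1 A R) AR.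
by exists (J |` F); apply: joining_search run joinF.
Qed.

(* The search and merge choices always lead to a terminating run. *)
Lemma praster_total mu N b S : exists final, praster mu N b S final.
Proof.
rewrite /praster; elim: N.-1 (init_state _ _ _ _) => [|i IHi] s.
  by exists s; constructor.
have [F joinF] := joining_total [fset A in candidates s | touches N b i.+1 A].
have [s' step] : exists s', join_border mu N b i.+1 s s'.
  exact: ex_intro (JoinBorder mu joinF).
by have [final runF] := IHi s'; exists final; apply: join_bordersS step runF.
Qed.

(* Main.v *)
(** A cluster [C j] that is linked across [B_i] to another one touches [B_i],
    while, lying in slice [i] or [i+1], it touches no [B_k] with [k > i+1].
    Hence it stays a candidate of its own until border [i+1]; there it may be
    joined, but the result still touches [B_i] and so returns to the
    candidates. At border [i] every [C j] therefore lies in some candidate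
    touching [B_i]. When a depth-first search drops a cluster from its stack, no
    unvisited cluster is adjacent to it, and the unvisited set only shrinks; so
    adjacent candidates end in the same joined cluster, which spreads along the
    connected union of the [C j]. Uniqueness holds because no tile ever belongs
    to two clusters of a state. *)
Require Import Defs.
From mathcomp Require Import all_boot all_order all_algebra.
From mathcomp Require Import finmap.
From mathcomp Require Import zify.
Set Implicit Arguments.
Unset Strict Implicit.
Unset Printing Implicit Defensive.

Import Order.TTheory GRing.Theory Num.Theory.
Local Open Scope ring_scope.
Local Open Scope fset_scope.

(** * The neighbor graph, clusters and connectivity *)

Lemma neighbor_sym : symmetric neighbor.
Proof. by move=> t u; rewrite /neighbor (distrC t.1) (distrC t.2). Qed.

Lemma neighbor_dist1 t u : neighbor t u -> `|t.1 - u.1| <= 1.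
Proof. by move=> /eqP tu; rewrite -tu le_max lexx. Qed.

Lemma adjacentP (A B : {fset tile}) :
  reflect (exists t u, [/\ t \in A, u \in B & neighbor t u]) (adjacent A B).
Proof.
apply: (iffP existsP) => [[t /existsP[u tu]]|[t [u [tA uB tu]]]].
  by exists (val t), (val u); split=> //; apply: valP.
by exists [` tA]; apply/existsP; exists [` uB].
Qed.

Lemma adjacent_sym : symmetric adjacent.
Proof.
by move=> A B; apply/adjacentP/adjacentP => -[t [u [tA uB tu]]];
  exists u, t; rewrite neighbor_sym.
Qed.

Lemma adjacent_sub (A A' B B' : {fset tile}) :
  A `<=` A' -> B `<=` B' -> adjacent A B -> adjacent A' B'.
Proof.
move=> /fsubsetP sA /fsubsetP sB /adjacentP[t [u [/sA tA /sB uB tu]]].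
by apply/adjacentP; exists t, u.
Qed.

Lemma linked_sym (A : {fset tile}) : symmetric (@linked A).
Proof. by apply: sym_connect_sym => t u; rewrite neighbor_sym. Qed.

Lemma clustersP (A X : {fset tile}) :
  X \in clusters A ->
  exists t : A, forall u, u \in X <-> exists2 v : A, linked t v & u = val v.
Proof.
move=> /imfsetP[t _ ->]; exists t => u; split.
  by move=> /imfsetP[v /= tv ->]; exists v.
by move=> [v tv ->]; apply/imfsetP; exists v.
Qed.

Lemma cluster_neq0 (A X : {fset tile}) : X \in clusters A -> exists t, t \in X.
Proof.
move=> /clustersP[t XP]; exists (val t); apply/XP.
by exists t => //; apply: connect0.
Qed.

Lemma cluster_sub (A X : {fset tile}) : X \in clusters A -> X `<=` A.
Proof.
by move=> /clustersP[t XP]; apply/fsubsetP => _ /XP[v _ ->]; apply: valP.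
Qed.

Lemma cluster_closed (A X : {fset tile}) t u :
  X \in clusters A -> t \in X -> u \in A -> neighbor t u -> u \in X.
Proof.
move=> /clustersP[x XP] /XP[v xv ->] uA vu; apply/XP; exists [` uA] => //.
exact: connect_trans xv (connect1 _).
Qed.

(* Disjointness of a family is stated tile by tile, so that a possible empty
   member needs no separate treatment. *)
Definition tile_disjoint (P : {fset {fset tile}}) : Prop :=
  forall A B t, A \in P -> B \in P -> t \in A -> t \in B -> A = B.

Lemma tile_disjoint_sub P Q : P `<=` Q -> tile_disjoint Q -> tile_disjoint P.
Proof. by move=> /fsubsetP sPQ dQ A B t /sPQ + /sPQ; apply: dQ. Qed.

Lemma clusters_disjoint A : tile_disjoint (clusters A).
Proof.
move=> X Y t /clustersP[x XP] /clustersP[y YP] /XP[v xv ->] /YP[w yw] /val_inj vw.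
have xy : linked x y.
  by apply: connect_trans xv _; rewrite vw -/(linked w y) linked_sym.
apply/fsetP => u; apply/idP/idP.
  move=> /XP[z xz ->]; apply/YP; exists z => //.
  by apply: connect_trans xz; rewrite -/(linked y x) linked_sym.
by move=> /YP[z yz ->]; apply/XP; exists z => //; apply: connect_trans yz.
Qed.

(** Induction along a path inside [U]. Connectivity of the union of the [C j] is exploited only in
    this form, with [X] first a single cluster and later a joined one. *)
Lemma connected_closed (U X : {fset tile}) :
  connected U -> (exists2 t, t \in U & t \in X) ->
  (forall t u, t \in U -> u \in U -> t \in X -> neighbor t u -> u \in X) ->
  U `<=` X.
Proof.
move=> conU [t tU tX] clX; apply/fsubsetP => u uU.
have /connectP[p] := conU [` tU] [` uU].
elim: p t tU tX => [|v p IHp] t tU tX /=.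
  by move=> _ /(congr1 val) /= ->.
move=> /andP[tv vp] lastp; have vU := valP v.
have vX : val v \in X by exact: clX tU vU tX tv.
by apply: (IHp (val v) vU vX); rewrite (_ : [` vU] = v) //; apply: val_inj.
Qed.

(** * Contact with a border, then the search and the grouping at one border *)

Lemma touchesP N b k A :
  reflect ((0 < k < N)%N /\ exists2 t : tile, t \in A & t.1 = b k - 1 \/ t.1 = b k)
          (touches N b k A).
Proof.
apply: (iffP andP) => -[-> ].
  move=> /existsP[t]; rewrite !inE => tk; split=> //; exists (val t) => //.
    exact: valP.
  by case/orP: tk => /eqP; [left|right].
move=> [t tA tk]; split=> //; apply/existsP; exists [` tA].
by rewrite !inE /=; case: tk => ->; rewrite eqxx ?orbT.
Qed.

Lemma touches_sub N b k (A B : {fset tile}) :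
  A `<=` B -> touches N b k A -> touches N b k B.
Proof.
move=> /fsubsetP sAB /touchesP[kN [t /sAB tB tk]].
by apply/touchesP; split=> //; exists t.
Qed.

Lemma touches0 N b A : touches N b 0 A = false.
Proof. by []. Qed.

(** The last clause treats stacked and visited clusters alike, because a found cluster moves from
    [R] onto the stack. The fourth clause, that [J'] gains tiles from visited clusters only, is what
    later yields disjointness. *)
Lemma dfsP R s J R' J' : Defs.dfs R s J R' J' ->
  [/\ R' `<=` R, J `<=` J',
      forall B, B \in R -> B \notin R' -> B `<=` J',
      forall t, t \in J' ->
        t \in J \/ exists B, [/\ B \in R, B \notin R' & t \in B]
    & forall A B, (A \in s) || (A \in R `\` R') -> B \in R' -> ~~ adjacent A B].
Proof.
elim=> {R s J R' J'} [R J|R A s J B R' J' BR AB _ [sR sJ vis cov clo]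
                     |R A s J R' J' noB _ [sR sJ vis cov clo]].
- split=> // [B ->//|t|A B]; first by left.
  by rewrite fsetDv.
- have BR' : B \notin R'.
    by apply/negP => /(fsubsetP sR); rewrite !inE eqxx.
  split.
  + exact: fsubset_trans sR (fsubD1set _ _).
  + exact: fsubset_trans (fsubsetUl _ _) sJ.
  + move=> X XR XR'; have [->|XB] := eqVneq X B.
      exact: fsubset_trans (fsubsetUr _ _) sJ.
    by apply: vis; rewrite // !inE XB.
  + move=> t /cov[|[X [XR XR' tX]]].
      by rewrite inE => /orP[|tB]; [left|right; exists B].
    by right; exists X; split=> //; move: XR; rewrite !inE => /andP[].
  + move=> X Y XsR YR'; apply: clo => //; move: XsR; rewrite !inE.
    by case: (X == B); rewrite ?orbT //= => /orP[/orP[]|] ->; rewrite ?orbT.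
- split=> // X Y; rewrite inE -orbA => /orP[/eqP->|XsR] YR'; last exact: clo.
  exact: noB (fsubsetP sR _ YR').
Qed.

(** Adjacent clusters cannot be separated, since a search leaves no unvisited cluster adjacent to a
    visited one. A tile shared by [J] and a later joined cluster would lie in a visited and in an
    unvisited cluster, which disjointness of [R] forbids. *)
Lemma joiningP R F : joining R F ->
  [/\ forall J t, J \in F -> t \in J -> exists2 A, A \in R & t \in A,
      forall A, A \in R -> exists2 J, J \in F & A `<=` J,
      forall A B, A \in R -> B \in R -> adjacent A B ->
        exists J, [/\ J \in F, A `<=` J & B `<=` J]
    & tile_disjoint R -> tile_disjoint F].
Proof.
elim=> {R F} [|R A R' J F AR /dfsP[sR sJ vis cov clo] _ [IHcov IHsub IHadj IHdis]].
  by split=> // A; rewrite ?inE.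
have AR' : A \notin R' by apply/negP => /(fsubsetP sR); rewrite !inE eqxx.
have sR'R : R' `<=` R by exact: fsubset_trans sR (fsubD1set _ _).
have visJ B : B \in R -> B \notin R' -> B `<=` J.
  by move=> BR BR'; have [->//|BA] := eqVneq B A; apply: vis; rewrite // !inE BA.
have covJ t : t \in J -> exists B, [/\ B \in R, B \notin R' & t \in B].
  move=> /cov[tA|[B [BR BR' tB]]]; first by exists A.
  by exists B; split=> //; move: BR; rewrite !inE => /andP[].
have cloJ B B' : B \in R -> B \notin R' -> B' \in R' -> ~~ adjacent B B'.
  move=> BR BR'; apply: clo; rewrite !inE BR BR' /=.
  by case: (B == A).
split.
- move=> K t; rewrite !inE => /orP[/eqP->|KF] tK.
    by have [B [BR _ tB]] := covJ t tK; exists B.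
  by have [B /(fsubsetP sR'R) BR tB] := IHcov K t KF tK; exists B.
- move=> B BR; have [/IHsub[K KF sBK]|BR'] := boolP (B \in R').
    by exists K; rewrite // !inE KF orbT.
  by exists J; rewrite ?inE ?eqxx //; apply: visJ.
- move=> B B' BR B'R BB'.
  have [BR'|BR'] := boolP (B \in R'); have [B'R'|B'R'] := boolP (B' \in R').
  + have [K [KF sB sB']] := IHadj B B' BR' B'R' BB'.
    by exists K; rewrite !inE KF orbT.
  + by rewrite adjacent_sym (negbTE (cloJ _ _ B'R B'R' BR')) in BB'.
  + by rewrite (negbTE (cloJ _ _ BR BR' B'R')) in BB'.
  + by exists J; rewrite !inE eqxx; split=> //; apply: visJ.
- move=> disR; have disF := IHdis (tile_disjoint_sub sR'R disR).
  have JF K t : K \in F -> t \in J -> t \in K -> J = K.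
    move=> KF tJ tK; have [B [BR BR' tB]] := covJ t tJ.
    have [B' B'R' tB'] := IHcov K t KF tK.
    have eqB := disR _ _ _ BR (fsubsetP sR'R _ B'R') tB tB'.
    by rewrite eqB B'R' in BR'.
  move=> K L t; rewrite !inE => /orP[/eqP->|KF] /orP[/eqP->|LF] // tK tL.
  + exact: JF LF tK tL.
  + by rewrite (JF K t KF tL tK).
  + exact: disF tK tL.
Qed.

(** * Disjointness and inclusion along a run *)

Definition done (s : state) : {fset {fset tile}} := output s `|` discarded s.

(** The last clause makes this stronger than [tile_disjoint] of the union, which would let one
    cluster be both candidate and done; joining such a cluster to others could produce an overlap
    with its finished copy. *)
Definition disjoint_state (s : state) : Prop :=
  [/\ tile_disjoint (candidates s), tile_disjoint (done s)
    & forall A B t,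
        A \in candidates s -> B \in done s -> t \in A -> t \notin B].

Lemma disjoint_stateU s :
  disjoint_state s -> tile_disjoint (candidates s `|` done s).
Proof.
move=> [dC dD dCD] A B t.
rewrite in_fsetU => /orP[Ac|AD]; rewrite in_fsetU => /orP[Bc|BD] tA tB.
- exact: dC tA tB.
- by have := dCD _ _ _ Ac BD tA; rewrite tB.
- by have := dCD _ _ _ Bc AD tB; rewrite tA.
- exact: dD tA tB.
Qed.

Lemma join_borderP mu N b i s s' : join_border mu N b i s s' ->
  exists F, let Clr := [fset A in candidates s | touches N b i A] in
  [/\ joining Clr F,
      forall A, (A \in candidates s') =
        (A \in candidates s) && ~~ touches N b i A ||
        (A \in F) && touches N b i.-1 A
    & forall A, (A \in done s') =
        (A \in done s) || (A \in F) && ~~ touches N b i.-1 A].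
Proof.
case=> F Clr joinF; exists F; split=> // A; rewrite /done /= !inE /=.
  by case: (A \in candidates s) => /=; rewrite ?andbT ?andbF.
rewrite ltnNge; case: (A \in output s); case: (A \in discarded s) => //=;
  by case: (A \in F); case: touches; case: (_ <= _)%N.
Qed.

(** Every tile of a joined cluster comes from a candidate removed at this border, so it lies neither
    in a kept candidate nor in a finished cluster. *)
Lemma join_border_disjoint mu N b i s s' :
  join_border mu N b i s s' -> disjoint_state s -> disjoint_state s'.
Proof.
move=> /join_borderP[F [/joiningP[cov _ _ dis] cE dE]] [dC dD dCD].
have sClr : [fset A in candidates s | touches N b i A] `<=` candidates s.
  by apply/fsubsetP => A; rewrite !inE => /andP[].
have {}dis := dis (tile_disjoint_sub sClr dC).
have keepF A J t : A \in candidates s -> ~~ touches N b i A -> J \in F ->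
    t \in A -> t \notin J.
  move=> Ac Ai JF tA; apply/negP => tJ; have [B] := cov J t JF tJ.
  rewrite !inE /= => /andP[Bc Bi] tB.
  by rewrite (dC _ _ _ Ac Bc tA tB) Bi in Ai.
have doneF A J t : A \in done s -> J \in F -> t \in A -> t \notin J.
  move=> AD JF tA; apply/negP => tJ; have [B /(fsubsetP sClr) Bc tB] := cov J t JF tJ.
  by have := dCD _ _ _ Bc AD tB; rewrite tA.
split=> A B t; rewrite ?cE ?dE.
- move=> /orP[/andP[Ac Ai]|/andP[AF _]] /orP[/andP[Bc Bi]|/andP[BF _]] tA tB.
  + exact: dC tA tB.
  + by have := keepF _ _ _ Ac Ai BF tA; rewrite tB.
  + by have := keepF _ _ _ Bc Bi AF tB; rewrite tA.
  + exact: dis tA tB.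
- move=> /orP[AD|/andP[AF _]] /orP[BD|/andP[BF _]] tA tB.
  + exact: dD tA tB.
  + by have := doneF _ _ _ AD BF tA; rewrite tB.
  + by have := doneF _ _ _ BD AF tB; rewrite tA.
  + exact: dis tA tB.
- move=> /orP[/andP[Ac Ai]|/andP[AF Ai]] /orP[BD|/andP[BF Bi]] tA.
  + exact: dCD tA.
  + exact: keepF tA.
  + by apply/negP => tB; have := doneF _ _ _ BD AF tB; rewrite tA.
  (* Two members of [F] sharing a tile coincide, but here one touches border [i.-1] and the other
     does not. *)
  + by apply/negP => tB; rewrite -(dis _ _ _ AF BF tA tB) Ai in Bi.
Qed.

Lemma join_borders_disjoint mu N b k s s' :
  join_borders mu N b k s s' -> disjoint_state s -> disjoint_state s'.
Proof.
elim=> // {}k {s s'} s s1 s' step _ IH ds.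
exact: IH (join_border_disjoint step ds).
Qed.

(* A joined cluster is returned to the candidates only when it touches the next
   border, so it is taken up again there and never stays behind. *)
Lemma join_borders_done mu N b k s s' A :
  join_borders mu N b k s s' ->
  (A \in candidates s) && touches N b k A || (A \in done s) ->
  exists2 D, D \in done s' & A `<=` D.
Proof.
move=> run; elim: run A => {k s s'} [s|k s s1 s' /join_borderP[F [joinF cE dE]] _ IH] A.
  by rewrite touches0 andbF /= => AD; exists A.
move=> /orP[Ac|AD]; last by apply: IH; rewrite dE AD /= orbT.
have [_ sub _ _] := joiningP joinF.
have [|J JF sAJ] := sub A; first by rewrite !inE.
have [|D DD sJD] := IH J; last by exists D => //; apply: fsubset_trans sJD.
by rewrite cE dE JF /=; case: (touches N b k J); rewrite ?orbT.
Qed.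

(** * Slices do not overlap, so the initial state is disjoint *)

Section Borders.
Variables (N : nat) (b : nat -> int).
Hypothesis hb :
  forall j k : nat, (0 < j)%N -> (j < k)%N -> (k < N)%N -> b j < b k.

Lemma in_sliceP k t : in_slice N b k t ->
  ((1 < k)%N -> b k.-1 <= t.1) /\ ((k < N)%N -> t.1 < b k).
Proof. by move=> /andP[/implyP ? /implyP ?]. Qed.

Lemma border_le j k : (0 < j)%N -> (j <= k)%N -> (k < N)%N -> b j <= b k.
Proof.
move=> j0; rewrite leq_eqVlt => /orP[/eqP->//|jk] kN.
by apply: ltW; apply: hb.
Qed.

Lemma in_slice_inj k l t : (0 < k <= N)%N -> (0 < l <= N)%N ->
  in_slice N b k t -> in_slice N b l t -> k = l.
Proof.
wlog lt_kl : k l / (k < l)%N.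
  by move=> W; case: (ltngtP k l) => // lt hk hl ? ?; [|symmetry]; apply: W.
move=> /andP[k0 _] /andP[_ lN] /in_sliceP[_ /(_ (leq_trans lt_kl lN)) tk].
move=> /in_sliceP[/(_ (leq_ltn_trans k0 lt_kl)) tl _].
have : b k <= b l.-1 by apply: border_le; lia.
by move=> /le_trans /(_ tl); rewrite leNgt tk.
Qed.

Lemma slice_cluster_in S k A t :
  A \in clusters (slice N b S k) -> t \in A -> (t \in S) && in_slice N b k t.
Proof. by move=> /cluster_sub /fsubsetP sA /sA; rewrite !inE. Qed.

Lemma slice_clustersP S A :
  reflect (exists2 k, (0 < k <= N)%N & A \in clusters (slice N b S k))
          (A \in slice_clusters N b S).
Proof.
apply: (iffP (bigfcupP _ _ _ _)) => -[k kN Ak]; exists k => //.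
  by move: kN; rewrite andbT mem_iota; lia.
by rewrite andbT mem_iota; lia.
Qed.

Lemma slice_clusters_disjoint S : tile_disjoint (slice_clusters N b S).
Proof.
move=> A B t /slice_clustersP[k kN Ak] /slice_clustersP[l lN Bl] tA tB.
have /andP[_ tk] := slice_cluster_in Ak tA.
have /andP[_ tl] := slice_cluster_in Bl tB.
rewrite -(in_slice_inj kN lN tk tl) in Bl.
exact: clusters_disjoint Ak Bl tA tB.
Qed.

Lemma init_state_disjoint mu S : disjoint_state (init_state mu N b S).
Proof.
have dP := @slice_clusters_disjoint S.
split.
- apply: tile_disjoint_sub dP; apply/fsubsetP => A; rewrite !inE.
  by move=> /andP[].
- apply: tile_disjoint_sub dP; apply/fsubsetP => A; rewrite !inE.
  by move=> /orP[] /andP[].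
- move=> A B t; rewrite !inE /= => /andP[AP At] BP tA; apply/negP => tB.
  have {}BP : (B \in slice_clusters N b S) && ~~ touches_some N b B.
    by case/orP: BP => /and3P[-> ->].
  by case/andP: BP => BP; rewrite -(dP _ _ _ AP BP tA tB) At.
Qed.

End Borders.

(** * The fate of clusters connected across one border *)

Section JoinAcross.
Context {S : {fset tile}} {mu N : nat} {b : nat -> int}.
Hypothesis hb :
  forall j k : nat, (0 < j)%N -> (j < k)%N -> (k < N)%N -> b j < b k.
Context {i : nat}.
Hypothesis hi : (0 < i < N)%N.
Context {r : nat} {C : 'I_r -> {fset tile}}.
Hypothesis hC : forall j, C j \in clusters (slice N b S i)
                       \/ C j \in clusters (slice N b S i.+1).
Let U := \bigcup_(j <- enum 'I_r) C j.
Hypothesis hconn : connected U.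

Lemma unionP t : reflect (exists j, t \in C j) (t \in U).
Proof.
apply: (iffP (bigfcupP _ _ _ _)) => -[j]; first by exists j.
by exists j; rewrite // mem_enum.
Qed.

Lemma C_neq0 j : exists t, t \in C j.
Proof. by case: (hC j) => /cluster_neq0. Qed.

Lemma sub_union j : C j `<=` U.
Proof. by apply/fsubsetP => t tC; apply/unionP; exists j. Qed.

Lemma C_slice_clusters j : C j \in slice_clusters N b S.
Proof.
apply/slice_clustersP; case: (hC j) => Cj; [exists i|exists i.+1] => //; lia.
Qed.

Lemma C_not_touches k j : (i.+1 < k)%N -> ~~ touches N b k (C j).
Proof.
move=> ik; apply/negP => /touchesP[kN [t tC tk]].
have bi : b i < b i.+1 by apply: hb; lia.
have bk : b i.+1 < b k by apply: hb; lia.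
(* Over the integers [b i.+1 < b k] gives [b i.+1 <= b k - 1], so [t] lies to the left of both
   columns at border [k]. *)
suff : t.1 < b i.+1 by lia.
have [Cj|Cj] := hC j; have /andP[_ /in_sliceP[_ tb]] := slice_cluster_in Cj tC.
  by apply: lt_trans bi; apply: tb; lia.
by apply: tb; lia.
Qed.

(** From [t.1 < b i <= u.1] and a horizontal distance of at most 1, the columns are forced to be
    [b i - 1] and [b i]. *)
Lemma cross_touches j l (t u : tile) :
  C j \in clusters (slice N b S i) -> C l \in clusters (slice N b S i.+1) ->
  t \in C j -> u \in C l -> neighbor t u ->
  touches N b i (C j) && touches N b i (C l).
Proof.
move=> Cj Cl tC uC /neighbor_dist1 tu.
have /andP[_ /in_sliceP[_ tb]] := slice_cluster_in Cj tC.
have /andP[_ /in_sliceP[ub _]] := slice_cluster_in Cl uC.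
have {}tb : t.1 < b i by apply: tb; lia.
have {}ub : b i <= u.1 by apply: ub; lia.
by apply/andP; split; apply/touchesP; split=> //;
  [exists t => //; left|exists u => //; right]; lia.
Qed.

(** Otherwise no neighbor pair leaves [C j] across the border, and within its slice [C j] is already
    maximal. It would then contain all of [U], hence [C l], against disjointness. *)
Lemma C_touches j l : C j != C l -> touches N b i (C j).
Proof.
move=> Cjl; apply/negPn/negP => nt.
have sUC : U `<=` C j.
  have [t tC] := C_neq0 j.
  apply: connected_closed => //.
    by exists t => //; apply: (fsubsetP (sub_union j)).
  move=> {t tC} t u _ /unionP[m uC] tC tu.
  have [Cj|Cj] := hC j; have [Cm|Cm] := hC m.
  - exact: cluster_closed Cj tC (fsubsetP (cluster_sub Cm) _ uC) tu.
  - by have := cross_touches Cj Cm tC uC tu; rewrite (negbTE nt).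
  - rewrite neighbor_sym in tu.
    by have := cross_touches Cm Cj uC tC tu; rewrite (negbTE nt) andbF.
  - exact: cluster_closed Cj tC (fsubsetP (cluster_sub Cm) _ uC) tu.
have [u uC] := C_neq0 l.
have uCj := fsubsetP sUC _ (fsubsetP (sub_union l) _ uC).
case/eqP: Cjl; apply: (slice_clusters_disjoint hb) uCj uC; exact: C_slice_clusters.
Qed.

Hypothesis touchC : forall j, touches N b i (C j).

(** The joined cluster [J] that holds [C j0] is closed under neighbors inside [U], so it spreads
    over the whole connected union. *)
Lemma join_border_all s s' (j0 : 'I_r) :
  join_border mu N b i s s' -> disjoint_state s ->
  (forall j, exists2 A, A \in candidates s & C j `<=` A) ->
  exists2 J, U `<=` J &
    (J \in candidates s') && touches N b i.-1 J || (J \in done s').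
Proof.
move=> /join_borderP[F [joinF cE dE]] [dC _ _] held.
have [_ sub adj dis] := joiningP joinF.
have {}dis : tile_disjoint F.
  apply: dis; apply: tile_disjoint_sub dC; apply/fsubsetP => A.
  by rewrite !inE => /andP[].
have {}held j : exists2 A,
    A \in [fset A in candidates s | touches N b i A] & C j `<=` A.
  have [A Ac sCA] := held j; exists A => //; rewrite !inE Ac.
  exact: touches_sub sCA (touchC j).
have [A0 A0R sCA0] := held j0; have [J JF sA0J] := sub _ A0R.
exists J; last first.
  by rewrite cE dE JF /=; case: (touches N b i.-1 J); rewrite ?orbT.
apply: connected_closed => //.
  have [t tC] := C_neq0 j0; exists t; first exact: (fsubsetP (sub_union j0)).
  exact: fsubsetP (fsubset_trans sCA0 sA0J) _ tC.
move=> t u /unionP[j tC] /unionP[l uC] tJ tu.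
have [A AR sCA] := held j; have [B BR sCB] := held l.
(* [A] and [B] inherit adjacency from [t] and [u]. Their common joined cluster [K] shares [t] with
   [J], and disjointness of [F] identifies the two. *)
have [|K [KF sAK sBK]] := adj A B AR BR.
  by apply: adjacent_sub sCA sCB _; apply/adjacentP; exists t, u.
have tK := fsubsetP sAK _ (fsubsetP sCA _ tC).
by rewrite (dis _ _ _ JF KF tJ tK); apply: (fsubsetP sBK); apply: (fsubsetP sCB).
Qed.

(** Here [k] is the next border to process. The induction needs the exact equality [A = C j] before
    border [i.+1] comes up, to rule out contact with farther borders; from then on inclusion
    suffices. *)
Lemma join_borders_all k s s' (j0 : 'I_r) :
  join_borders mu N b k s s' -> (i <= k)%N -> disjoint_state s ->
  (forall j, exists A, [/\ A \in candidates s, C j `<=` A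
                         & (i.+1 < k)%N -> A = C j]) ->
  exists2 D, D \in done s' & U `<=` D.
Proof.
elim=> {k s s'} [s|k s s1 s' step run IH]; first by case/andP: hi; case: (i).
rewrite leq_eqVlt => /orP[/eqP ik|ik] ds held.
  rewrite -ik in step.
  have [|J sUJ JC] := join_border_all j0 step ds.
    by move=> j; have [A [Ac sCA _]] := held j; exists A.
  rewrite ik /= in JC.
  have [D DD sJD] := join_borders_done run JC.
  by exists D => //; apply: fsubset_trans sJD.
apply: IH => //; first exact: join_border_disjoint step ds.
move=> j; have [A [Ac sCA AE]] := held j.
have [F [joinF cE _]] := join_borderP step.
have [tA|ntA] := boolP (touches N b k.+1 A); last first.
  by exists A; rewrite cE Ac ntA; split=> // ik1; apply: AE; lia.
(* The border being processed is [k.+1]. If it were beyond [i.+1], then [A] would still be [C j],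
   which does not reach that far. *)
have ki : k = i.
  apply/eqP; rewrite eqn_leq -(ltnS i) ik andbT leqNgt; apply/negP => ki.
  by rewrite AE // (negbTE (C_not_touches j _)) in tA.
have [_ sub _ _] := joiningP joinF.
have [|J JF sAJ] := sub A; first by rewrite !inE Ac.
have sCJ := fsubset_trans sCA sAJ.
exists J; split=> //; last by lia.
by rewrite cE JF /= ki (touches_sub sCJ (touchC j)) orbT.
Qed.

End JoinAcross.

Theorem theorem1 (S : {fset tile}) (mu N : nat) (b : nat -> int)
  (hb : forall j k : nat, (0 < j)%N -> (j < k)%N -> (k < N)%N -> b j < b k)
  (i : nat) (hi : (1 <= i <= N - 1)%N)
  (r : nat) (hr : (2 <= r)%N)
  (C : 'I_r -> {fset tile}) (C_inj : injective C)
  (hC : forall j, C j \in clusters (slice N b S i)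
               \/ C j \in clusters (slice N b S i.+1))
  (hconn : connected (\bigcup_(j <- enum 'I_r) C j))
  (final : state) (hfinal : praster mu N b S final) :
  exists D : {fset tile},
    [/\ D \in output final `|` discarded final,
        forall j, C j `<=` D
      & forall (j : 'I_r) (E : {fset tile}),
          E \in candidates final `|` output final `|` discarded final ->
          C j `<=` E -> E = D].
Proof.
have hi' : (0 < i < N)%N by lia.
have touchC j : touches N b i (C j).
  have [l jl] : exists l : 'I_r, j != l.
    (* As [r] is at least 2, both indices 1 ([Ordinal hr]) and 0 ([Ordinal (ltnW hr)]) exist, and
       one of them differs from [j]. *)
    exists (if val j == 0%N then Ordinal hr else Ordinal (ltnW hr)).
    by case: ifP => [/eqP jE|/negbT jE]; rewrite -val_eqE /= ?jE.
  by apply: (C_touches hb hi' hC hconn (l := l)); rewrite (inj_eq C_inj).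
have d0 := init_state_disjoint hb mu S.
have j0 : 'I_r := Ordinal (ltnW hr).
have [||D DD sUD] := join_borders_all hb hi' hC hconn touchC j0 hfinal _ d0.
- by lia.
- move=> j; exists (C j); split=> //; rewrite !inE (C_slice_clusters hi' hC) /=.
  by case/andP: hi' => _ iN; apply/existsP; exists (Ordinal iN).
have sCD j : C j `<=` D := fsubset_trans (sub_union j) sUD.
exists D; split=> // j E EP sCE; have [t tC] := C_neq0 hC j.
(* Uniqueness: a tile of the nonempty [C j] lies in both [E] and [D], and the final state is
   disjoint. *)
apply: (disjoint_stateU (join_borders_disjoint hfinal d0)) (fsubsetP sCE _ tC)
  (fsubsetP (sCD j) _ tC).
  by rewrite /done fsetUA.
by rewrite in_fsetU DD orbT.
Qed.
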